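(* Let $r\in\mathbb{N}$, and let $A,B\subseteq\mathbb{N}$ be such that $A$ is an $IP^{\star}$ set in $\mathbb{N}$ and $B$ is an $IP_{r}^{\star}$ set in $\mathbb{N}$. Then there exists $k\in\mathbb{N}$ such that $k\cdot\mathbb{N}\subseteq A\cdot B$, where $k\cdot\mathbb{N}=\{kn:n\in\mathbb{N}\}$ and $A\cdot B=\{ab:a\in A,\ b\in B\}$.
   Context: A set $C\subseteq\mathbb{N}$ is an $IP$ set if there is a sequence $\langle x_n\rangle_{n\in\mathbb{N}}$ in $\mathbb{N}$ such that $C\supseteq\{\sum_{t\in H}x_t : H \text{ a nonempty finite subset of } \mathbb{N}\}$. For $r\in\mathbb{N}$, $C$ is an $IP_r$ set if there are $x_1,\ldots,x_r\in\mathbb{N}$ such that $C\supseteq\{\sum_{t\in H}x_t : \emptyset\neq H\subseteq\{1,2,\ldots,r\}\}$. A set is an $IP^{\star}$ set (resp. $IP_r^{\star}$ set) if it has nonempty intersection with every $IP$ set (resp. every $IP_r$ set) in $\mathbb{N}$. *)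

(* Defs.v *)
From mathcomp Require Import all_boot finmap.
From mathcomp Require Import classical_sets.

Set Implicit Arguments.
Unset Strict Implicit.
Unset Printing Implicit Defensive.

Local Open Scope classical_set_scope.

(* The natural numbers here start at 1. Allowing 0 would change the theory: the
   zero sequence would make {0} an IP set. *)
Definition Npos : set nat := [set n | 0 < n].

(* The indices of the sequence serve only as labels, so they range over all of
   nat, including 0. *)
Definition IP_set (C : set nat) : Prop :=
  C `<=` Npos /\
  exists x : nat -> nat, (forall n, Npos (x n)) /\
    [set \sum_(t <- H) x t | H in [set H : {fset nat} | H != fset0%fset]] `<=` C.

Definition IPr_set (r : nat) (C : set nat) : Prop :=
  C `<=` Npos /\
  exists x : 'I_r -> nat, (forall i, Npos (x i)) /\
    [set \sum_(t in H) x t | H in [set H : {set 'I_r} | H != finset.set0]] `<=` C.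

Definition IP_star_set (A : set nat) : Prop :=
  forall C : set nat, IP_set C -> A `&` C !=set0.

Definition IPr_star_set (r : nat) (A : set nat) : Prop :=
  forall C : set nat, IPr_set r C -> A `&` C !=set0.

Definition dilate (k : nat) (X : set nat) : set nat := [set k * n | n in X].

Definition prodset (A B : set nat) : set nat := [set a * b | a in A & b in B].

(* Main.v *)
Require Import Defs.
From mathcomp Require Import all_boot finmap.
From mathcomp Require Import boolp classical_sets filter.
Local Open Scope classical_set_scope.

(** For fixed [s > 0] the preimage of an IP* set under multiplication by [s] is
    IP*, and finitely many IP* sets meet because all of them belong to any
    idempotent ultrafilter of [(nat, +)] containing the positive integers. Hence
    there is [m > 0] with [m * (r! / i) \in A] for all [1 <= i <= r], and
    [k = m * r!] works: given [n], the multiples [n, 2 n, ..., r n] form an IP_r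
    set, so some [i * n] lies in [B], and [k * n = (m * (r! / i)) * (i * n)].

    The idempotent ultrafilter comes from the Ellis-Numakura argument, with closed
    subsemigroups of the Stone-Cech compactification replaced by the filters they
    determine, so that no topology on ultrafilters is needed. *)

(* If [F] and [G] are ultrafilters this is their sum in the Stone-Cech
   compactification of [nat]. *)
Definition filter_add (F G : set_system nat) : set_system nat :=
  [set A | F [set n | G (addn n @^-1` A)]].

(* The condition [F `<=` filter_add F F] says that the ultrafilters containing [F]
   form a closed subsemigroup. *)
Definition semigroup_filter (F : set_system nat) : Prop :=
  [/\ ProperFilter F, \oo `<=` F & F `<=` filter_add F F].

Lemma preimage_addnD m n (A : set nat) :
  addn n @^-1` (addn m @^-1` A) = addn (m + n) @^-1` A.
Proof. by apply/seteqP; split=> k; rewrite /preimage /= addnA. Qed.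

Lemma semigroup_filter_eventually : semigroup_filter \oo.
Proof.
split=> // [|A [N _ NA]]; first exact: eventually_filter.
exists 0 => // n _; exists N => // k /= Nk; apply: NA => /=.
exact: leq_trans Nk (leq_addl _ _).
Qed.

Lemma semigroup_filter_bigcup (C : set (set_system nat)) :
  (forall F, C F -> F !=set0 -> semigroup_filter F) -> total_on C subset ->
  \bigcup_(F in C) F !=set0 -> semigroup_filter (\bigcup_(F in C) F).
Proof.
move=> Csg Ctot [A0 [F0 CF0 F0A0]].
have sg F A : C F -> F A -> semigroup_filter F.
  by move=> CF FA; apply: Csg => //; exists A.
have [F0pf F0oo _] := sg _ _ CF0 F0A0.
split.
- split=> [[F CF F0']|]; first by have [[]] := sg _ _ CF F0'.
  split; first by exists F0 => //; exact: filterT.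
  + move=> A B [F CF FA] [G CG GB].
    have [Fpf _ _] := sg _ _ CF FA; have [Gpf _ _] := sg _ _ CG GB.
    have [FG|GF] := Ctot _ _ CF CG.
    * by exists G => //; apply: filterI => //; exact: FG.
    * by exists F => //; apply: filterI => //; exact: GF.
  + move=> A B AB [F CF FA]; have [Fpf _ _] := sg _ _ CF FA.
    by exists F => //; exact: filterS FA.
- by move=> A ooA; exists F0 => //; exact: F0oo.
- move=> A [F CF FA]; have [Fpf _ Fadd] := sg _ _ CF FA.
  exists F => //; move: (Fadd _ FA); rewrite /filter_add /=; apply: filterS => n Fn.
  by exists F.
Qed.

(** A maximal filter of this kind corresponds to a minimal closed subsemigroup. *)
Lemma maximal_semigroup_filter :
  exists2 F, semigroup_filter F &
    forall G, semigroup_filter G -> F `<=` G -> G = F.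
Proof.
(* The guard [F !=set0] admits the union of the empty chain, which is not a filter. *)
have [|F [Fsg Fmax]] :=
  @Zorn_bigcup _ [set F : set_system nat | F !=set0 -> semigroup_filter F].
  by move=> C CP Ctot /=; apply: semigroup_filter_bigcup.
have sg_ne (G : set_system nat) : semigroup_filter G -> G !=set0.
  by case=> Gpf _ _; exists setT; exact: filterT.
have max G : semigroup_filter G -> F `<=` G -> G = F.
  move=> Gsg FG; apply: contrapT => GF; apply: (Fmax G) => //.
  by split=> // GsF; apply: GF; apply/seteqP.
(* If [F] were empty, maximality would equate it with [\oo], which is not. *)
exists F => //; apply: Fsg; apply: contrapT => F0.
have oosg := semigroup_filter_eventually.
case: (F0); rewrite -(max _ oosg); first exact: sg_ne.
by move=> A FA; case: F0; exists A.
Qed.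

(** If S is the closed semigroup of ultrafilters containing [F], then for an ultrafilter [p] in S
    this is the filter of the subsemigroup S + [p] of S. *)
Lemma filter_add_semigroup F p : semigroup_filter F -> ProperFilter p ->
  F `<=` p -> semigroup_filter (filter_add F p) /\ F `<=` filter_add F p.
Proof.
move=> [Fpf Foo Fadd] ppf Fp.
have sub : F `<=` filter_add F p.
  by move=> A /Fadd; rewrite /filter_add /=; apply: filterS => n; exact: Fp.
split=> //; split; last 2 first.
- by apply: subset_trans sub.
- move=> A /Fadd FA; apply: sub; move: FA; rewrite /filter_add /=.
  apply: filterS => m; apply: filterS => n /=.
  by rewrite preimage_addnD.
- split.
    rewrite /filter_add /= => F0; apply: (filter_not_empty F).
    apply: filterS F0 => n.
    by move=> /(filter_not_empty p).
  split.
  + by apply: sub; exact: filterT.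
  + rewrite /filter_add => A B /= FA FB.
    apply: filterS (filterI FA FB) => n [/= pA pB].
    by rewrite preimage_setI; exact: filterI.
  + move=> A B AB; rewrite /filter_add /=; apply: filterS => n; apply: filterS.
    exact: preimage_subset.
Qed.

(* The filter of the closed semigroup of those [q] containing [F] with
   [q + p = p]. *)
Definition stabilizer_filter (F p : set_system nat) : set_system nat :=
  [set D | exists2 B, F B & exists2 A, p A &
    B `&` [set n | p (addn n @^-1` A)] `<=` D].

Lemma stabilizer_filter_semigroup F p : semigroup_filter F -> UltraFilter p ->
  F `<=` p -> filter_add F p = F ->
  semigroup_filter (stabilizer_filter F p) /\ F `<=` stabilizer_filter F p.
Proof.
move=> [Fpf Foo Fadd] pU Fp FpE.
have sub : F `<=` stabilizer_filter F p.
  move=> B FB; exists B => //; exists setT; first exact: filterT.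
  by move=> n [].
split=> //; split; last 2 first.
- exact: subset_trans sub.
- move=> D [B FB [A pA BAD]].
  exists [set n | F (addn n @^-1` B)]; first exact: Fadd.
  exists A => // m [/= FBm pAm].
  exists (addn m @^-1` B) => //; exists (addn m @^-1` A) => //.
  move=> n [Bmn]; rewrite /= preimage_addnD => pAmn.
  exact: BAD.
- split.
    move=> [B FB [A pA BA0]].
    (* The equation [filter_add F p = F] makes the stabilizer nonempty: without it, [A] and its
       complement could not both be forced into [p]. *)
    have : F (~` A).
      rewrite -FpE; apply: filterS FB => n Bn /=.
      have [pn|//] := in_ultra_setVsetC (addn n @^-1` A) pU.
      by case: (BA0 n).
    move=> /Fp pnA; apply: (filter_not_empty p).
    by rewrite -(setICr A); exact: filterI.
  split.
  + by apply: sub; exact: filterT.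
  + move=> D1 D2 [B1 FB1 [A1 pA1 s1]] [B2 FB2 [A2 pA2 s2]].
    exists (B1 `&` B2); first exact: filterI.
    exists (A1 `&` A2); first exact: filterI.
    move=> n [[B1n B2n]]; rewrite /= preimage_setI => pn.
    split; [apply: s1|apply: s2]; split=> //=; apply: filterS pn => k [] //.
  + move=> D1 D2 D12 [B FB [A pA s]]; exists B => //; exists A => //.
    exact: subset_trans D12.
Qed.

Lemma idempotent_ultrafilter :
  exists p, [/\ UltraFilter p, \oo `<=` p & p `<=` filter_add p p].
Proof.
have [F Fsg Fmax] := maximal_semigroup_filter.
have [Fpf Foo Fadd] := Fsg.
have [p [pU Fp]] := ultraFilterLemma Fpf.
have FpE : filter_add F p = F.
  by have [? ?] := filter_add_semigroup _ _ Fsg _ Fp; exact: Fmax.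
have stabE : stabilizer_filter F p = F.
  by have [? ?] := stabilizer_filter_semigroup _ _ Fsg pU Fp FpE; exact: Fmax.
suff pF : p = F by exists p; split=> //; rewrite pF.
(* The set of [n] whose translate of [A] lies in [p] belongs to the stabilizer filter by definition,
   with [B] the full set. *)
apply/seteqP; split=> // A pA; rewrite -FpE /filter_add /= -stabE.
by exists setT; [exact: filterT|exists A => // n []].
Qed.

(* The tail sums starting at index [n] stay in [D n]: the standard extraction of
   an IP set from a member of an idempotent ultrafilter. *)
Lemma sum_path_in (D : nat -> set nat) (x : nat -> nat) :
  (forall n, D n (x n)) ->
  (forall n, D n.+1 `<=` D n `&` addn (x n) @^-1` D n) ->
  forall n s, path ltn n s -> D n (\sum_(t <- n :: s) x t).
Proof.
move=> Dx DS n s; elim: s n => [|m s IH] n /=.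
  by rewrite big_seq1.
move=> /andP[nm ms]; rewrite big_cons.
have Dmono k : D (n.+1 + k) `<=` D n.+1.
  elim: k => [|k IHk]; first by rewrite addn0.
  by rewrite addnS => y /DS[/IHk].
have /DS[] // : D n.+1 (\sum_(t <- m :: s) x t).
by apply: (Dmono (m - n.+1)); rewrite subnKC //; exact: IH.
Qed.

(** Idempotence gives each [D] in [p] a point [y] of [D] such that the translate of [D] by [-y] is
    in [p]; intersecting [D] with it and iterating yields the sequence. *)
Lemma idempotent_IP_set p (C : set nat) : ProperFilter p ->
  p `<=` filter_add p p -> p C -> C `<=` Npos -> IP_set C.
Proof.
move=> ppf padd pC Cpos; split=> //.
have step (D : {D : set nat | p D}) :
    {y : nat | sval D y /\ p (addn y @^-1` sval D)}.
  apply/cid; case: D => D pD /=.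
  by have [y [? ?]] := filter_ex (filterI pD (padd _ pD)); exists y.
pose next (D : {D : set nat | p D}) : {D : set nat | p D} :=
  exist _ (sval D `&` addn (sval (step D)) @^-1` sval D)
    (@filterI _ p (@filter_filter _ p ppf) _ _ (svalP D) (svalP (step D)).2).
pose D n := iter n next (exist _ C pC).
pose x n := sval (step (D n)).
have xD n : sval (D n) (x n) by exact: (svalP (step (D n))).1.
have DS n : sval (D n.+1) `<=` sval (D n) `&` addn (x n) @^-1` sval (D n) by [].
have DC n : sval (D n) `<=` C.
  by elim: n => [//|n IH] y /DS[/IH].
exists x; split=> [n|_ [H /= H0 <-]].
  exact/Cpos/(DC n)/xD.
(* Listing [H] in increasing order makes [sum_path_in] applicable. *)
rewrite -(perm_big _ (permEl (perm_sort leq H))).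
have : sorted ltn (sort leq H).
  by rewrite ltn_sorted_uniq_leq sort_uniq fset_uniq sort_sorted //; exact: leq_total.
case E : (sort leq H) => [|n s] ns.
  by case/fset0Pn: H0 => t; rewrite -(mem_sort leq) E.
exact/(DC n)/(sum_path_in _ _ xD DS).
Qed.

Lemma IP_star_idempotent p (A : set nat) : UltraFilter p ->
  \oo `<=` p -> p `<=` filter_add p p -> IP_star_set A -> p A.
Proof.
move=> pU poo padd AIP; have [//|pnA] := in_ultra_setVsetC A pU.
have pN : p Npos by apply: poo; exists 1.
have : IP_set (~` A `&` Npos).
  by apply: (@idempotent_IP_set p) => //; exact: filterI.
by move=> /AIP[n [An []]].
Qed.

Lemma IP_star_preimage_muln s (A : set nat) : 0 < s ->
  IP_star_set A -> IP_star_set (muln s @^-1` A).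
Proof.
move=> s0 AIP C [Cpos [x [xpos xC]]].
have /AIP[y [Ay [m Cm mE]]] : IP_set (muln s @` C).
  split=> [_ [m /Cpos m0 <-]|]; first by rewrite /Npos /= muln_gt0 s0.
  exists (fun t => s * x t); split=> [n|_ [H H0 <-]].
    by rewrite /Npos /= muln_gt0 s0; exact: xpos.
  rewrite -big_distrr /=; exists (\sum_(t <- H) x t) => //.
  by apply: xC; exists H.
by exists m; split=> //; rewrite /preimage /= mE.
Qed.

Lemma IP_star_common_dilation (I : finType) (s : I -> nat) (A : set nat) :
  (forall i, 0 < s i) -> IP_star_set A ->
  exists2 m, 0 < m & forall i, A (s i * m).
Proof.
move=> s0 AIP; have [p [pU poo padd]] := idempotent_ultrafilter.
have pN : p Npos by apply: poo; exists 1.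
have pA i : p (muln (s i) @^-1` A).
  by apply: IP_star_idempotent => //; exact: IP_star_preimage_muln.
have pAs : p [set m | forall i, A (s i * m)] by exact: filter_forall pA.
have [m [m0 mA]] := filter_ex (filterI pN pAs).
by exists m.
Qed.

Lemma IPr_star_multiple r n (B : set nat) : 0 < n -> IPr_star_set r B ->
  exists2 i, 0 < i <= r & B (i * n).
Proof.
move=> n0 BIP.
have /BIP[b [Bb [i ir iE]]] :
    IPr_set r [set i * n | i in [set i | 0 < i <= r]].
  split=> [_ [i /= /andP[i0 _] <-]|]; first by rewrite /Npos /= muln_gt0 i0.
  (* The constant sequence has the sums [#|H| * n]. *)
  exists (fun=> n); split=> [//|_ [H /= H0 <-]].
  exists #|H|; last by rewrite sum_nat_const.
  by rewrite /= card_gt0 H0 -[X in _ <= X](card_ord r) max_card.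
by exists i => //; rewrite iE.
Qed.

Theorem theorem3 (r : nat) (A B : set nat) (hr : Npos r)
  (hA : A `<=` Npos) (hB : B `<=` Npos)
  (hAIP : IP_star_set A) (hBIP : IPr_star_set r B) :
  exists k : nat, Npos k /\ dilate k Npos `<=` prodset A B.
Proof.
have fact_div i : 0 < i <= r -> (r`! %/ i) * i = r`!.
  by move=> ir; rewrite divnK // dvdn_fact.
(* The ordinal [i] stands for the divisor [i.+1] of [r!], so the divisors run from 1 to [r]. *)
have [|m m0 mA] :=
  IP_star_common_dilation 'I_r (fun i => r`! %/ i.+1) A _ hAIP.
  move=> i; have := fact_gt0 r; rewrite -{1}(fact_div i.+1) ?ltn_ord //.
  by rewrite muln_gt0 => /andP[].
exists (m * r`!); split=> [|_ [n n0 <-]].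
  by rewrite /Npos /= muln_gt0 m0 fact_gt0.
have [i ir Bin] := IPr_star_multiple r n B n0 hBIP.
have [i0 ir'] := andP ir.
have ir1 : i.-1 < r by rewrite prednK.
exists (r`! %/ i * m); first by have := mA (Ordinal ir1); rewrite /= prednK.
exists (i * n) => //.
by rewrite mulnACA fact_div // mulnCA mulnA.
Qed.
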